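(* Let $\mathbf{G}=\mathbf{N}\bowtie\mathbf{H}$ be a finite group which is the internal knit product of its subgroups $\mathbf{N}$ and $\mathbf{H}$, with $\mathbf{H}$ Abelian, and put $\mathfrak{g}=|\mathbf{G}|$, $\mathfrak{n}=|\mathbf{N}|$, $\mathfrak{h}=|\mathbf{H}|$. Let $g\mapsto U(g)$ be a unitary representation of $\mathbf{G}$ on a complex Hilbert space $\mathcal{H}$, let $\mathsf{a}\in\mathcal{H}$ be such that the family $\{U(g)\mathsf{a}\}_{g\in\mathbf{G}}$ is linearly independent, let $\mathcal{A}_{\mathsf{a}}=\operatorname{span}\{U(g)\mathsf{a}\}_{g\in\mathbf{G}}$, and let $\mathsf{b}_1,\dots,\mathsf{b}_\kappa\in\mathcal{H}$. Let $\mathcal{L}_k\mathsf{f}(\tau_n)$ be the generalized samples and $\mathbb{R}_{\mathsf{a},\mathbf{b}}$ the $\mathfrak{h}\kappa\times\mathfrak{g}$ cross-covariance matrix defined in the context. The following statements are equivalent: 1. $\operatorname{rank}\mathbb{R}_{\mathsf{a},\mathbf{b}}=\mathfrak{g}$. 2. There exists an $\mathfrak{n}\times\mathfrak{h}\kappa$ complex matrix $\mathbb{S}$ such that $\mathbb{S}\,\mathbb{R}_{\mathsf{a},\mathbf{b}}=\big(\mathbb{I}_{\mathfrak{n}}\ \ \mathbb{O}_{\mathfrak{n}\times(\mathfrak{g}-\mathfrak{n})}\big)$. 3. There exist vectors $\mathsf{d}_k\in\mathcal{A}_{\mathsf{a}}$, $k=1,\dots,\kappa$, such that $\{U(\tau_n)\mathsf{d}_k\}_{k=1,\dots,\kappa;\,n=1,\dots,\mathfrak{h}}$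 is a frame for $\mathcal{A}_{\mathsf{a}}$, and for any $\mathsf{f}\in\mathcal{A}_{\mathsf{a}}$ we have $$\mathsf{f}=\sum_{k=1}^{\kappa}\sum_{n=1}^{\mathfrak{h}}\mathcal{L}_k\mathsf{f}(\tau_n)\,U(\tau_n)\mathsf{d}_k .$$ 4. There exists a frame $\{\mathsf{D}_{k,n}\}_{k=1,\dots,\kappa;\,n=1,\dots,\mathfrak{h}}$ for $\mathcal{A}_{\mathsf{a}}$ such that, for each $\mathsf{f}\in\mathcal{A}_{\mathsf{a}}$, $$\mathsf{f}=\sum_{k=1}^{\kappa}\sum_{n=1}^{\mathfrak{h}}\mathcal{L}_k\mathsf{f}(\tau_n)\,\mathsf{D}_{k,n}.$$
   Context: $\mathbf{G}$ is the internal knit (Zappa–Szép) product $\mathbf{N}\bowtie\mathbf{H}$ of subgroups $\mathbf{N},\mathbf{H}$ if $\mathbf{G}=\mathbf{N}\mathbf{H}$ and $\mathbf{N}\cap\mathbf{H}=\{1_{\mathbf{G}}\}$. Fix enumerations $\mathbf{N}=\{\nu_1=1_{\mathbf{G}},\nu_2,\dots,\nu_{\mathfrak{n}}\}$ and $\mathbf{H}=\{\tau_1=1_{\mathbf{G}},\tau_2,\dots,\tau_{\mathfrak{h}}\}$; then $\mathbf{G}=\bigcup_{j=1}^{\mathfrak{h}}\tau_j^{-1}\mathbf{N}$ (disjoint union), and $\mathbf{G}$ is listed in the order $\tau_1^{-1}\nu_1,\dots,\tau_1^{-1}\nu_{\mathfrak{n}},\tau_2^{-1}\nu_1,\dots,\tau_2^{-1}\nu_{\mathfrak{n}},\dots,\tau_{\mathfrak{h}}^{-1}\nu_{\mathfrak{n}}$.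 Inner products are linear in the first argument. Generalized samples: $\mathcal{L}_k\mathsf{f}(\tau_n):=\langle\mathsf{f},U(\tau_n)\mathsf{b}_k\rangle_{\mathcal{H}}$ for $\mathsf{f}\in\mathcal{A}_{\mathsf{a}}$, $n=1,\dots,\mathfrak{h}$, $k=1,\dots,\kappa$. Cross-covariance: $r_{\mathsf{a},\mathsf{b}}(g):=\langle U(g)\mathsf{a},\mathsf{b}\rangle_{\mathcal{H}}$, $g\in\mathbf{G}$. For each $k$, $\mathbb{R}_{\mathsf{a},\mathsf{b}_k}$ is the $\mathfrak{h}\times\mathfrak{g}$ matrix whose entry in row $n$ and in the column indexed by $\tau_j^{-1}\nu_i$ (the columns being indexed by $\mathbf{G}$ listed in the order $\tau_1^{-1}\nu_1,\dots,\tau_1^{-1}\nu_{\mathfrak{n}},\tau_2^{-1}\nu_1,\dots,\tau_2^{-1}\nu_{\mathfrak{n}},\dots,\tau_{\mathfrak{h}}^{-1}\nu_{\mathfrak{n}}$) is $r_{\mathsf{a},\mathsf{b}_k}(\tau_n^{-1}\tau_j^{-1}\nu_i)=r_{\mathsf{a},\mathsf{b}_k}(\tau_j^{-1}\tau_n^{-1}\nu_i)$. The cross-covariance matrix $\mathbb{R}_{\mathsf{a},\mathbf{b}}$ is the $\mathfrak{h}\kappa\times\mathfrak{g}$ matrix obtained by stacking $\mathbb{R}_{\mathsf{a},\mathsf{b}_1},\dots,\mathbb{R}_{\mathsf{a},\mathsf{b}_\kappa}$ vertically in this order. $\mathbb{I}_{m}$ is the identity matrix of order $m$ and $\mathbb{O}_{m\times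 p}$ the $m\times p$ zero matrix. A finite family $\{x_i\}$ in a finite-dimensional Hilbert space $V$ is a frame for $V$ if there are $0<A\le B$ with $A\|x\|^2\le\sum_i|\langle x,x_i\rangle|^2\le B\|x\|^2$ for all $x\in V$; equivalently, it spans $V$. *)

(* Defs.v *)
From HB Require Import structures.
From mathcomp Require Import all_boot all_order all_algebra all_fingroup.
From mathcomp Require Import sesquilinear.
From mathcomp.real_closed Require Import complex.
From mathcomp Require Import classical_sets reals topology normedtype.
Set Implicit Arguments.
Unset Strict Implicit.
Unset Printing Implicit Defensive.

Import Order.TTheory GRing.Theory Num.Theory.
Import numFieldNormedType.Exports.

Local Open Scope ring_scope.
Local Open Scope complex_scope.

Definition knit_product (gT : finGroupType) (G N H : {group gT}) : Prop :=
  (N * H)%g = G :> {set gT} /\ (N :&: H)%g = 1%g :> {set gT}.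

Definition enumerates (gT : finGroupType) (A : {group gT})
    (s : #|A|.-tuple gT) : Prop :=
  [/\ uniq s, s =i A & ohead s = Some 1%g].

(* [:: t1^-1 * x1; ...; t1^-1 * xn; t2^-1 * x1; ...; th^-1 * xn] *)
Definition knit_enum (gT : finGroupType) (tau nu : seq gT) : seq gT :=
  [seq (t^-1 * x)%g | t <- tau, x <- nu].

Lemma knit_enumP (gT : finGroupType) (G N H : {group gT})
    (nu : #|N|.-tuple gT) (tau : #|H|.-tuple gT) :
  knit_product G N H -> enumerates nu -> enumerates tau ->
  [/\ uniq (knit_enum tau nu), knit_enum tau nu =i G &
      size (knit_enum tau nu) = #|G|].
Proof.
move=> [NH NIH] [nuU nuN _] [tauU tauH _].
have sz : size (knit_enum tau nu) = #|G|.
  by rewrite size_allpairs !size_tuple -NH TI_cardMg // mulnC.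
have HN : (H * N)%g = G.
  by rewrite -NH; apply/esym/comm_group_setP; rewrite NH groupP.
have GE : knit_enum tau nu =i G.
  move=> g; apply/allpairsP/idP => [[[t x] /= [tH xN ->]]|].
    rewrite tauH in tH; rewrite nuN in xN.
    by rewrite -HN mem_mulg ?groupV.
  rewrite -HN => /mulsgP[t x tH xN ->].
  by exists (t^-1%g, x); rewrite /= invgK tauH nuN groupV.
split=> //; apply/card_uniqP.
by rewrite sz; apply: eq_card.
Qed.

Section Hilbert.
Variables (R : realType) (V : completeNormedModType R[i]).

(* A complex Hilbert space is a complete normed space over R[i] whose norm is
   the one induced by dot, which is linear in its first argument and
   conjugate-linear in the second one. *)
Definition hilbert_dot (dot : {dot V for Num.conj}) : Prop :=
  forall x : V, `|x| ^+ 2 = dot x x.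

Definition unitary (dot : {dot V for Num.conj}) (u : {linear V -> V}) : Prop :=
  (forall x y : V, dot (u x) (u y) = dot x y) /\ (forall y, exists x, u x = y).

Definition unitary_representation (dot : {dot V for Num.conj})
    (gT : finGroupType) (G : {group gT}) (U : gT -> {linear V -> V}) : Prop :=
  [/\ forall x, U 1%g x = x,
      {in G &, forall g h x, U (g * h)%g x = U g (U h x)} &
      {in G, forall g, unitary dot (U g)}].

Definition lin_indep_on (I : finType) (A : {set I}) (x : I -> V) : Prop :=
  forall c : I -> R[i], \sum_(i in A) c i *: x i = 0 ->
  {in A, forall i, c i = 0}.

Definition span_on (I : finType) (A : {set I}) (x : I -> V) : set V :=
  [set y | exists c : I -> R[i], y = \sum_(i in A) c i *: x i]%classic.

(* The ambient space W is meant to be a finite-dimensional subspace of V. *)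
Definition frame (dot : {dot V for Num.conj}) (W : set V)
    (I : finType) (x : I -> V) : Prop :=
  (forall i, W (x i)) /\
  exists A B : R, [/\ 0 < A, A <= B &
    forall y, W y ->
      A%:C * `|y| ^+ 2 <= \sum_i `|dot y (x i)| ^+ 2 <= B%:C * `|y| ^+ 2].

Variables (dot : {dot V for Num.conj}) (gT : finGroupType).
Variable U : gT -> {linear V -> V}.

Definition sample (b f : V) (t : gT) : R[i] := dot f (U t b).

Definition cross_cov (a b : V) (g : gT) : R[i] := dot (U g a) b.

(* The columns are meant to be indexed by the g elements of the list s. *)
Definition cross_cov_block (h g : nat) (tau : h.-tuple gT) (s : seq gT)
    (a b : V) : 'M[R[i]]_(h, g) :=
  \matrix_(n < h, c < g) cross_cov a b ((tnth tau n)^-1 * nth 1 s c)%g.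

Definition cross_cov_mx (kappa h g : nat) (tau : h.-tuple gT) (s : seq gT)
    (a : V) (b : 'I_kappa -> V) : 'M[R[i]]_(\sum_(k < kappa) h, g) :=
  \mxcol_(k < kappa) cross_cov_block g tau s a (b k).

End Hilbert.

(* Main.v *)
Require Import Defs.
From HB Require Import structures.
From mathcomp Require Import all_boot all_order all_algebra all_fingroup.
From mathcomp Require Import sesquilinear.
From mathcomp.real_closed Require Import complex.
From mathcomp Require Import classical_sets reals topology normedtype.
Set Implicit Arguments.
Unset Strict Implicit.
Unset Printing Implicit Defensive.

Import Order.TTheory GRing.Theory Num.Theory.
Import numFieldNormedType.Exports.

Local Open Scope ring_scope.
Local Open Scope complex_scope.

(** Write a vector of the span as [f = \sum_(g in G) c g *: U g a].  Since [U] is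
    unitary, the samples of [f] are the entries of the cross-covariance matrix
    applied to the column of the coefficients [c g] ([cross_cov_mx_coef]), so
    recovering [f] from its samples is a matter of inverting that matrix on the
    left.

    A left inverse exists exactly when the rank is [#|G|], and its first [#|N|]
    rows form the matrix [S] of the second condition.  Conversely such an [S]
    recovers from the samples only the coefficients [c x] with [x] in [N]
    ([left_inverse_coef]).  The symmetry of the sampling scheme supplies the
    others: for [t] in [H], the coefficients of [U t f] are those of [f]
    translated by [t], and the samples of [U t f] are a permutation of those of
    [f], so that [S] also gives [c (t^-1 * x)].  These are all the coefficients
    because every element of [G] is uniquely [t^-1 * x].  Collecting the terms that
    contain the same sample yields a reconstruction formula whose vectors are
    the translates [U t (d k)] of [kappa] fixed vectors ([reconstruction]).

    The frame inequalities come for free with any formula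
    [f = \sum_i dot f (y i) *: x i]: the upper one is Cauchy-Schwarz, and the lower
    one follows by pairing the formula with [f] ([frame_of_reconstruction]).

    Finally, if the samples determine [f], then a column killed by the matrix is
    the coefficient column of a vector with zero samples, which is zero; linear
    independence makes the column zero, so the matrix has full column rank. *)

(** * Frames from reconstruction formulas *)

(** Expanding [0 <= dot z z] for [z = dot y y *: x - dot x y *: y] gives
    [dot y y] times the right-hand side minus the left-hand side. *)
Lemma dot_cauchy_schwarz (C : numClosedFieldType) (V : lmodType C)
    (dot : {dot V for Num.conj}) (x y : V) :
  `|dot x y| ^+ 2 <= dot x x * dot y y.
Proof.
have [->|y0] := eqVneq y 0; first by rewrite !linear0r normr0 expr0n mulr0.
have yy0 : 0 < dot y y by rewrite dnorm_gt0.
have := dnorm_ge0 dot (dot y y *: x - dot x y *: y).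
rewrite dnormB !dnormZ linearZl_LR linearZr_LR /=.
rewrite (ger0_norm (ltW yy0)) !rmorphM /= !conjCK (geC0_conj (ltW yy0)).
rewrite [(_)^* * _]mulrC -normCK [dot y y * _]mulrC opprD addrA addrK expr2.
by rewrite -mulrA [`|_| ^+ 2 * _]mulrC -mulrBr pmulr_rge0 // subr_ge0 mulrC.
Qed.

Section Frame.
Variables (R : realType) (V : completeNormedModType R[i]).
Variables (dot : {dot V for Num.conj}).

(** Pairing the formula with [f] gives
    [`|f| ^+ 2 <= \sum_i `|dot f (y i)| * `|dot f (x i)|].  The arithmetic-geometric
    mean inequality with weight [1 + \sum_i `|y i| ^+ 2] and the Bessel bound for
    [y] make the contribution of [y] at most half of [`|f| ^+ 2]; moved to the left,
    it leaves the lower frame inequality for [x]. *)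
Lemma frame_of_reconstruction (W : set V) (I : finType) (x y : I -> V) :
  hilbert_dot dot -> (forall i, W (x i)) ->
  (forall f, W f -> f = \sum_i dot f (y i) *: x i) ->
  frame dot W x.
Proof.
move=> hilbertV Wx rec; split=> //.
have bessel (z : I -> V) f :
    \sum_i `|dot f (z i)| ^+ 2 <= `|f| ^+ 2 * \sum_i `|z i| ^+ 2.
  rewrite mulr_sumr; apply: ler_sum => i _.
  by rewrite !hilbertV dot_cauchy_schwarz.
have real_bound (z : I -> V) :
    exists2 r : R, 0 <= r & r%:C = \sum_i `|z i| ^+ 2.
  have z_ge0 : 0 <= \sum_i `|z i| ^+ 2 by apply: sumr_ge0 => i _; rewrite exprn_ge0.
  have zE := RRe_real (ger0_real z_ge0).
  by exists (complex.Re (\sum_i `|z i| ^+ 2)); rewrite // -lecR zE.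
have [p p0 pE] := real_bound x; have [q q0 qE] := real_bound y.
have q1 : 0 < 1 + q by rewrite ltr_pwDl.
(* The 1 keeps the lower bound positive when all the y i vanish; adding it to p
   makes the upper bound at least the lower one. *)
exists (1 + q)^-1, ((1 + q)^-1 + p); split.
- by rewrite invr_gt0.
- by rewrite lerDl.
move=> f Wf; apply/andP; split; last first.
  apply: le_trans (bessel x f) _; rewrite mulrC -pE ler_wpM2r ?exprn_ge0 //.
  by rewrite lecR lerDr invr_ge0 ltW.
set c := (1 + q)%:C; have c0 : 0 < c by rewrite ltcR.
rewrite fmorphV -/c mulrC ler_pdivrMr // mulrC.
have key : `|f| ^+ 2 <= \sum_i `|dot f (y i)| * `|dot f (x i)|.
  rewrite -[leLHS]ger0_norm ?exprn_ge0 // hilbertV {2}(rec f Wf).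
  rewrite linear_sumr; apply: le_trans (ler_norm_sum _ _ _) _.
  by apply: ler_sum => i _; rewrite linearZr_LR /= normrM norm_conjC.
(* Adding c * |f|^2 to both sides turns the goal into the doubled inequality
   2 c |f|^2 <= c |f|^2 + c^2 \sum_i |dot f (x i)|^2. *)
rewrite -(ler_pM2l c0) -(lerD2l (c * `|f| ^+ 2)) -mulr2n -mulrnAr.
apply: (@le_trans _ _ (\sum_i (`|dot f (y i)| ^+ 2 + (c * `|dot f (x i)|) ^+ 2))).
  rewrite mulrnAr; apply: (@le_trans _ _
    (c * (\sum_i `|dot f (y i)| * `|dot f (x i)|) *+ 2)).
    by rewrite lerMn2r ler_pM2l // key orbT.
  rewrite mulr_sumr -sumrMnl; apply: ler_sum => i _; rewrite mulrCA.
  apply: real_leif_mean_square_scaled; first exact: normr_real.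
  by rewrite realM ?normr_real ?gtr0_real.
rewrite big_split /=; apply: lerD.
  apply: le_trans (bessel y f) _; rewrite mulrC ler_wpM2r ?exprn_ge0 //.
  by rewrite -qE lecR lerDr.
rewrite mulrA !mulr_sumr; apply: ler_sum => i _.
by rewrite exprMn expr2.
Qed.
End Frame.

(** * Sums over enumerated groups *)

Lemma big_enum_nth (gT : finGroupType) (V : nmodType) (A : {set gT})
    (n : nat) (s : seq gT) (F : gT -> V) :
  uniq s -> s =i A -> size s = n ->
  \sum_(g in A) F g = \sum_(j < n) F (nth 1%g s j).
Proof.
move=> sU sA <-; rewrite -(eq_bigl _ _ sA) -big_uniq //=.
by rewrite (big_nth 1%g) big_mkord.
Qed.

Lemma big_tuple_enum (gT : finGroupType) (V : nmodType) (A : {group gT})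
    (s : #|A|.-tuple gT) (F : gT -> V) :
  enumerates s -> \sum_(g in A) F g = \sum_(n < #|A|) F (tnth s n).
Proof.
move=> [sU sA _]; rewrite (big_enum_nth _ sU sA (size_tuple s)).
by apply: eq_bigr => n _; rewrite (tnth_nth 1%g).
Qed.

Lemma enumerates_mem (gT : finGroupType) (A : {group gT})
    (s : #|A|.-tuple gT) (n : 'I_#|A|) :
  enumerates s -> tnth s n \in A.
Proof. by move=> [_ <- _]; exact: mem_tnth. Qed.

Lemma big_knit (gT : finGroupType) (G N H : {group gT})
    (nu : #|N|.-tuple gT) (tau : #|H|.-tuple gT) (V : nmodType)
    (F : gT -> V) :
  knit_product G N H -> enumerates nu -> enumerates tau ->
  \sum_(g in G) F g = \sum_(t in H) \sum_(x in N) F (t^-1 * x)%g.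
Proof.
move=> knitG nuN tauH; have [eU eG _] := knit_enumP knitG nuN tauH.
rewrite -(eq_bigl _ _ eG) -big_uniq //= big_allpairs_dep.
have [tauU tauE _] := tauH; have [nuU nuE _] := nuN.
rewrite big_uniq //= (eq_bigl _ _ tauE); apply: eq_bigr => t _.
by rewrite big_uniq //= (eq_bigl _ _ nuE).
Qed.

(** As [tau] starts with the identity, the leading columns of the
    cross-covariance matrix are indexed by [N] itself. *)
Lemma nth_knit_enum (gT : finGroupType) (H : {group gT})
    (tau : #|H|.-tuple gT) (nu : seq gT) (i : nat) :
  enumerates tau -> (i < size nu)%N ->
  nth 1%g (knit_enum tau nu) i = nth 1%g nu i.
Proof.
case: tau => -[|t s] /= szs [_ _] //= [->] i_nu.
by rewrite nth_cat size_map i_nu (nth_map 1%g) // invg1 mul1g.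
Qed.

(** * Linear spans *)

Section Span.
Variables (R : realType) (V : completeNormedModType R[i]).
Variables (J : finType) (A : {set J}) (x : J -> V).

Lemma span_on_sum (I : finType) (F : I -> V) :
  (forall i, span_on A x (F i)) -> span_on A x (\sum_i F i).
Proof.
move=> /boolp.choice [c cE]; exists (fun g => \sum_i c i g).
under eq_bigr do rewrite cE.
by rewrite exchange_big; apply: eq_bigr => g _; rewrite scaler_suml.
Qed.

Lemma span_on_scale_gen (c : R[i]) (g : J) :
  g \in A -> span_on A x (c *: x g).
Proof.
move=> gA; exists (fun h => c *+ (h == g)).
rewrite (bigD1 g) //= eqxx big1 ?addr0 // => h /andP[_ /negPf->].
by rewrite scale0r.
Qed.
End Span.

(** * Samples and the cross-covariance matrix *)

Section CrossCovariance.
Variables (R : realType) (V : completeNormedModType R[i]).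
Variables (dot : {dot V for Num.conj}) (gT : finGroupType) (G : {group gT}).
Variables (U : gT -> {linear V -> V}) (a : V).
Hypothesis unitaryU : unitary_representation dot G U.

Lemma rep_mul : {in G &, forall g h x, U (g * h)%g x = U g (U h x)}.
Proof. by case: unitaryU. Qed.

Lemma dot_repl (t : gT) (x y : V) :
  t \in G -> dot x (U t y) = dot (U t^-1%g x) y.
Proof.
move=> tG; have [U1 _ /(_ t tG) [isoU _]] := unitaryU.
by rewrite -(isoU (U t^-1%g x)) -rep_mul ?groupV // mulgV U1.
Qed.

Lemma rep_sum_gen (t : gT) (c : gT -> R[i]) : t \in G ->
  U t (\sum_(g in G) c g *: U g a) = \sum_(g in G) c (t^-1 * g)%g *: U g a.
Proof.
move=> tG; rewrite linear_sum (reindex_inj (mulgI t^-1%g)) /=.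
rewrite (eq_bigl (mem G)) => [|g]; last by rewrite /= groupMl ?groupV.
apply: eq_bigr => g gG; rewrite linearZ_LR /= -rep_mul ?groupM ?groupV //.
by rewrite mulKVg.
Qed.

Definition coef_col (s : seq gT) (c : gT -> R[i]) : 'cV[R[i]]_#|G| :=
  \col_j c (nth 1%g s j).

(** Every column is the coefficient column of some family, so that statements
    about families of coefficients reach the kernel of the matrix. *)
Lemma coef_col_surj (s : seq gT) (v : 'cV[R[i]]_#|G|) :
  uniq s -> size s = #|G| -> exists c, coef_col s c = v.
Proof.
(* The default value 0 is only taken outside of s. *)
move=> sU szs; exists (fun g => oapp (v^~ 0) 0 (insub (index g s))).
apply/colP => j; rewrite mxE index_uniq ?szs //.
by rewrite valK.
Qed.

(** Moving [U t] across the inner product turns the entry indexed by [t] and [g],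
    the cross-covariance at [t^-1 * g], into the sample at [t] of [U g a]. *)
Lemma cross_cov_block_coef (h : nat) (tau : h.-tuple gT) (s : seq gT)
    (b : V) (c : gT -> R[i]) :
  uniq s -> s =i G -> size s = #|G| -> (forall n, tnth tau n \in G) ->
  cross_cov_block dot U #|G| tau s a b *m coef_col s c =
  \col_n sample dot U b (\sum_(g in G) c g *: U g a) (tnth tau n).
Proof.
move=> sU sG szs tauG; apply/matrixP => n j; rewrite !mxE /sample.
rewrite dot_repl // linear_sum linear_sumlz (big_enum_nth _ sU sG szs).
apply: eq_bigr => k _; rewrite !mxE linearZ_LR /= linearZl_LR /= mulrC.
by rewrite /cross_cov rep_mul ?groupV // -sG mem_nth ?szs.
Qed.
End CrossCovariance.

(** * Reconstruction along the subgroup H *)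

Section Sampling.
Variables (gT : finGroupType) (G N H : {group gT}).
Hypothesis knitG : knit_product G N H.
Variables (nu : #|N|.-tuple gT) (tau : #|H|.-tuple gT).
Hypotheses (nuN : enumerates nu) (tauH : enumerates tau).
Variables (R : realType) (V : completeNormedModType R[i]).
Variables (dot : {dot V for Num.conj}) (U : gT -> {linear V -> V}).
Hypothesis unitaryU : unitary_representation dot G U.
Variables (a : V) (kappa : nat) (b : 'I_kappa -> V).

Let R_ab := cross_cov_mx dot U #|G| tau (knit_enum tau nu) a b.

Lemma knit_subr : H \subset G.
Proof. by case: knitG => <- _; exact: mulG_subr. Qed.

Lemma knit_subl : N \subset G.
Proof. by case: knitG => <- _; exact: mulG_subl. Qed.

Lemma tau_memG n : tnth tau n \in G.
Proof. exact: (fintype.subsetP knit_subr) (enumerates_mem n tauH). Qed.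

Lemma nu_memG i : tnth nu i \in G.
Proof. exact: (fintype.subsetP knit_subl) (enumerates_mem i nuN). Qed.

Lemma cross_cov_mx_coef (c : gT -> R[i]) :
  R_ab *m coef_col G (knit_enum tau nu) c =
  \mxcol_k \col_n sample dot U (b k) (\sum_(g in G) c g *: U g a) (tnth tau n).
Proof.
have [eU eG sze] := knit_enumP knitG nuN tauH.
rewrite /R_ab /cross_cov_mx mxcol_mul; apply/eq_mxcol => k.
apply: cross_cov_block_coef => //; exact: tau_memG.
Qed.

(** The samples of [\sum_(g in G) c g *: U g a] form the image of the column of [c]
    under the matrix, so [S] sends them to the leading [#|N|] entries of that
    column, whichever family [c] was used to expand the vector. *)
Lemma left_inverse_coef (S : 'M[R[i]]_(#|N|, \sum_(k < kappa) #|H|))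
    (c : gT -> R[i]) (i : 'I_#|N|) :
  S *m R_ab = pid_mx #|N| ->
  c (tnth nu i) = \sum_k \sum_n
    submxrow S k i n *
    sample dot U (b k) (\sum_(g in G) c g *: U g a) (tnth tau n).
Proof.
move=> SR; have le_NG := subset_leq_card knit_subl.
transitivity ((S *m R_ab *m coef_col G (knit_enum tau nu) c) i 0).
  rewrite SR !mxE (bigD1 (widen_ord le_NG i)) //= big1 => [|j].
    rewrite !mxE eqxx ltn_ord mul1r addr0 /= nth_knit_enum ?size_tuple //.
    by rewrite -tnth_nth.
  rewrite -val_eqE /= => ji.
  by rewrite !mxE eq_sym (negPf ji) mul0r.
rewrite -mulmxA cross_cov_mx_coef -{1}(submxrowK S) mul_mxrow_mxcol.
rewrite summxE; apply: eq_bigr => k _.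
by rewrite mxE; under eq_bigr do rewrite [X in _ * X]mxE.
Qed.

(** The coefficient that [S] attaches to the sample at [tau n] enters the
    expansion of [f] in front of [U (m * (tau n)^-1 * nu i) a], where [m] is the
    element at which [f] is sampled.  Factoring [U m] out leaves these vectors. *)
Definition dual_vector (S : 'M[R[i]]_(#|N|, \sum_(k < kappa) #|H|)) k : V :=
  \sum_(n < #|H|) \sum_(i < #|N|)
     submxrow S k i n *: U ((tnth tau n)^-1 * tnth nu i)%g a.

Lemma dual_vector_span S k : span_on G (fun g => U g a) (dual_vector S k).
Proof.
apply: span_on_sum => n; apply: span_on_sum => i; apply: span_on_scale_gen.
by rewrite groupM ?groupV ?tau_memG ?nu_memG.
Qed.

(** Only the coefficients at [N] are read off by [S] directly; the one at
    [t^-1 * x] is the coefficient at [x] of [U t f]. *)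
Lemma reconstruction (S : 'M[R[i]]_(#|N|, \sum_(k < kappa) #|H|)) (f : V) :
  S *m R_ab = pid_mx #|N| ->
  span_on G (fun g => U g a) f ->
  f = \sum_k \sum_n sample dot U (b k) f (tnth tau n) *:
        U (tnth tau n) (dual_vector S k).
Proof.
move=> SR fA.
have HG h : h \in H -> h \in G by apply: (fintype.subsetP knit_subr).
have [c fE] := fA.
have cE t i : t \in H -> c (t^-1 * tnth nu i)%g =
    \sum_k \sum_n submxrow S k i n *
      sample dot U (b k) f (t^-1 * tnth tau n)%g.
  move=> tH; rewrite (left_inverse_coef (fun g => c (t^-1 * g)%g) i SR).
  rewrite -(rep_sum_gen a unitaryU) ?HG // -fE.
  apply: eq_bigr => k _; apply: eq_bigr => n _; congr (_ * _).
  rewrite /sample (dot_repl unitaryU) ?tau_memG // [RHS](dot_repl unitaryU);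
    last by rewrite groupM ?groupV ?tau_memG ?HG.
  by rewrite invMg invgK (rep_mul unitaryU) ?groupV ?tau_memG ?HG.
rewrite {1}fE (big_knit _ knitG nuN tauH).
pose F k n i t m := (submxrow S k i n * sample dot U (b k) f m) *:
  U (t^-1 * tnth nu i)%g a.
transitivity (\sum_k \sum_n \sum_i \sum_(t in H) F k n i t (t^-1 * tnth tau n)%g).
  under eq_bigr => t tH.
    rewrite (big_tuple_enum _ nuN); under eq_bigr => i _.
      rewrite cE // scaler_suml; under eq_bigr do rewrite scaler_suml.
      over.
    rewrite exchange_big; under eq_bigr do rewrite exchange_big.
    over.
  rewrite exchange_big; apply: eq_bigr => k _.
  rewrite exchange_big; apply: eq_bigr => n _.
  by rewrite exchange_big.
apply: eq_bigr => k _.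
rewrite -(big_tuple_enum (fun m => sample dot U (b k) f m *: U m (dual_vector S k)) tauH).
rewrite /dual_vector; under [RHS]eq_bigr => m mH.
  rewrite linear_sum scaler_sumr; under eq_bigr => n _.
    rewrite linear_sum scaler_sumr; over.
  over.
rewrite [RHS]exchange_big; apply: eq_bigr => n _ /=.
rewrite [RHS]exchange_big; apply: eq_bigr => i _ /=.
(* With t = tau n * m^-1, the vector f is sampled at t^-1 * tau n = m. *)
rewrite (reindex_inj invg_inj) (reindex_inj (mulIg (tnth tau n)^-1%g)) /=.
apply: eq_big => m; first by rewrite groupV groupMr // groupV (enumerates_mem n tauH).
rewrite groupV groupMr ?groupV ?(enumerates_mem n tauH) // => mH.
rewrite /F !invMg !invgK mulgKV -mulgA.
rewrite (rep_mul unitaryU) ?groupM ?groupV ?tau_memG ?nu_memG ?HG //.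
by rewrite linearZ_LR /= scalerA mulrC.
Qed.
End Sampling.

Theorem theorem5
  (gT : finGroupType) (G N H : {group gT})
  (knitG : knit_product G N H) (abelH : abelian H)
  (nu : #|N|.-tuple gT) (nuN : enumerates nu)
  (tau : #|H|.-tuple gT) (tauH : enumerates tau)
  (R : realType) (V : completeNormedModType R[i])
  (dot : {dot V for Num.conj}) (hilbertV : hilbert_dot dot)
  (U : gT -> {linear V -> V}) (unitaryU : unitary_representation dot G U)
  (a : V) (indep_a : lin_indep_on G (fun g => U g a))
  (kappa : nat) (b : 'I_kappa -> V) :
  let A_a := span_on G (fun g => U g a) in
  let R_ab : 'M[R[i]]_(\sum_(k < kappa) #|H|, #|G|) :=
    cross_cov_mx dot U #|G| tau (knit_enum tau nu) a b in
  let L k f n := sample dot U (b k) f (tnth tau n) in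
  [<->
    \rank R_ab = #|G|;
    exists S : 'M[R[i]]_(#|N|, \sum_(k < kappa) #|H|),
      S *m R_ab = pid_mx #|N|;
    exists d : 'I_kappa -> V,
      [/\ forall k, A_a (d k),
          frame dot A_a
            (fun kn : 'I_kappa * 'I_#|H| => U (tnth tau kn.2) (d kn.1)) &
          forall f, A_a f ->
            f = \sum_(k < kappa) \sum_(n < #|H|)
                  L k f n *: U (tnth tau n) (d k)];
    exists D : 'I_kappa -> 'I_#|H| -> V,
      frame dot A_a (fun kn : 'I_kappa * 'I_#|H| => D kn.1 kn.2) /\
      forall f, A_a f ->
        f = \sum_(k < kappa) \sum_(n < #|H|) L k f n *: D k n
  ].
Proof.
move=> A_a R_ab L.
have recP (D : 'I_kappa -> 'I_#|H| -> V) f :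
    \sum_(k < kappa) \sum_(n < #|H|) L k f n *: D k n =
    \sum_(kn : 'I_kappa * 'I_#|H|)
      dot f (U (tnth tau kn.2) (b kn.1)) *: D kn.1 kn.2.
  exact: pair_big.
tfae.
- move=> rkR; have /row_fullP[B BR] : row_full R_ab by rewrite /row_full rkR.
  by exists (pid_mx #|N| *m B); rewrite -mulmxA BR mulmx1.
- move=> [S SR]; pose d := dual_vector nu tau U a S.
  have recd f : A_a f -> f = \sum_(k < kappa) \sum_(n < #|H|)
      L k f n *: U (tnth tau n) (d k).
    exact: reconstruction.
  exists d; split=> // [k|]; first exact: dual_vector_span.
  apply: (frame_of_reconstruction (y := fun kn => U (tnth tau kn.2) (b kn.1))).
  + exact: hilbertV.
  + move=> [k n]; rewrite /d /=; have [c ->] := dual_vector_span knitG nuN tauH U a S k.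
    exists (fun g => c ((tnth tau n)^-1 * g)%g).
    by rewrite (rep_sum_gen a unitaryU) ?(tau_memG knitG tauH).
  + by move=> f fA; rewrite {1}(recd f fA) (recP (fun k n => U (tnth tau n) (d k))).
- move=> [d [_ dframe recd]].
  by exists (fun k n => U (tnth tau n) (d k)).
- move=> [D [_ recD]]; rewrite -mxrank_tr; apply/eqP/inj_row_free => v vR0.
  have [eU eG sze] := knit_enumP knitG nuN tauH.
  have [c cE] := coef_col_surj v^T eU sze.
  pose f := \sum_(g in G) c g *: U g a.
  have Lf0 k n : L k f n = 0.
    have Rc0 : R_ab *m coef_col G (knit_enum tau nu) c = 0.
      by rewrite cE -[R_ab]trmxK -trmx_mul vR0 trmx0.
    move: Rc0; rewrite /R_ab (cross_cov_mx_coef knitG nuN tauH unitaryU).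
    move=> /(congr1 (fun M => submxcol M k n 0)).
    by rewrite mxcolK submxcol0 !mxE.
  have f0 : f = 0.
    have fA : A_a f by exists c.
    rewrite (recD f fA) big1 // => k _; rewrite big1 // => n _.
    by rewrite Lf0 scale0r.
  apply: trmx_inj; rewrite -cE trmx0; apply/colP => j; rewrite !mxE.
  by apply: (indep_a c f0); rewrite -eG mem_nth ?sze.
Qed.
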